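(* Let $G$ be a connected graph. Then: 1. $EC(G)=1$ if and only if $G=K_2$. 2. $EC(G)=2$ if and only if $G\in\{P_3,\overline{C_4}\}$. (Equality and membership are up to isomorphism; $P_3$ is the path on three vertices and $\overline{C_4}$ is the complement of the cycle $C_4$.)
   Context: Graphs are finite and simple. Two distinct edges are adjacent if they share an endpoint. A set $D\subseteq E$ is an edge-dominating set of $G=(V,E)$ if every edge in $E\setminus D$ is adjacent to an edge of $D$. Two disjoint sets of edges $E_1,E_2$ form an edge coalition if neither is an edge-dominating set but $E_1\cup E_2$ is. An $ec$-partition of $G$ is a partition $\pi=\{E_1,\ldots,E_k\}$ of $E$ into nonempty sets such that every $E_i$ is either a singleton edge-dominating set, or is not an edge-dominating set but forms an edge coalition with another set $E_j$ of $\pi$. The edge coalition number $EC(G)$ is the maximum order $k$ of an $ec$-partition of $G$. *)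

(* Defs.v *)
From mathcomp Require Import all_boot.

Set Implicit Arguments.
Unset Strict Implicit.
Unset Printing Implicit Defensive.

Record sgraph := SGraph {
  vertex :> finType;
  adj : rel vertex;
  adj_sym : symmetric adj;
  adj_irrefl : irreflexive adj }.

(* The graph with no vertices does not count as connected. *)
Definition connected (G : sgraph) : Prop :=
  0 < #|G| /\ forall x y : G, connect (@adj G) x y.

Definition isomorphic (G H : sgraph) : Prop :=
  exists2 f : G -> H, bijective f & {mono f : x y / adj x y}.

Section StandardGraphs.

Variable n : nat.

Definition complete_rel : rel 'I_n := fun x y => x != y.

Fact complete_rel_sym : symmetric complete_rel.
Proof. by move=> x y; rewrite /complete_rel eq_sym. Qed.

Fact complete_rel_irrefl : irreflexive complete_rel.
Proof. by move=> x; rewrite /complete_rel eqxx. Qed.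

Definition complete_graph := SGraph complete_rel_sym complete_rel_irrefl.

Definition path_rel : rel 'I_n := fun x y => (x.+1 == y :> nat) || (y.+1 == x :> nat).

Fact path_rel_sym : symmetric path_rel.
Proof. by move=> x y; rewrite /path_rel orbC. Qed.

Fact path_rel_irrefl : irreflexive path_rel.
Proof. by move=> x; rewrite /path_rel orbb gtn_eqF. Qed.

Definition path_graph := SGraph path_rel_sym path_rel_irrefl.

(* A cycle in the usual sense when 3 <= n. *)
Definition cycle_rel : rel 'I_n := fun x y =>
  (x != y) && ((x.+1 %% n == y :> nat) || (y.+1 %% n == x :> nat)).

Fact cycle_rel_sym : symmetric cycle_rel.
Proof. by move=> x y; rewrite /cycle_rel eq_sym orbC. Qed.

Fact cycle_rel_irrefl : irreflexive cycle_rel.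
Proof. by move=> x; rewrite /cycle_rel eqxx. Qed.

Definition cycle_graph := SGraph cycle_rel_sym cycle_rel_irrefl.

End StandardGraphs.

Section Complement.

Variable G : sgraph.

Definition compl_rel : rel G := fun x y => (x != y) && ~~ adj x y.

Fact compl_rel_sym : symmetric compl_rel.
Proof. by move=> x y; rewrite /compl_rel eq_sym adj_sym. Qed.

Fact compl_rel_irrefl : irreflexive compl_rel.
Proof. by move=> x; rewrite /compl_rel eqxx. Qed.

Definition compl_graph := SGraph compl_rel_sym compl_rel_irrefl.

End Complement.

Section EdgeCoalitions.

Variable G : sgraph.

Definition edges : {set {set G}} :=
  [set a | [exists x : G, exists y : G, adj x y && (a == [set x; y])]].

Definition edge_adj (a b : {set G}) : bool := (a != b) && (a :&: b != set0).

Definition edge_dominating (D : {set {set G}}) : bool :=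
  (D \subset edges) &&
  [forall a in edges :\: D, [exists d in D, edge_adj a d]].

Definition edge_coalition (A B : {set {set G}}) : bool :=
  [&& A \subset edges, B \subset edges, [disjoint A & B],
      ~~ edge_dominating A, ~~ edge_dominating B & edge_dominating (A :|: B)].

Definition ec_partition (P : {set {set {set G}}}) : bool :=
  partition P edges &&
  [forall A in P,
     ((#|A| == 1) && edge_dominating A)
     || (~~ edge_dominating A && [exists B in P :\ A, edge_coalition A B])].

(* An edgeless graph has the empty partition, of order 0. A graph without any
   ec-partition would also get the value 0, so EC G = k with 0 < k always says
   that some ec-partition has order k and none has larger order. *)
Definition EC : nat := \max_(P : {set {set {set G}}} | ec_partition P) #|P|.

End EdgeCoalitions.

(* Main.v *)
Require Import Defs.
From mathcomp Require Import all_boot.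

(** In a connected graph with [m] edges, [minn m 3 <= EC G <= m]
    ([EC_geq_min_card_edges], [EC_leq_card_edges]).  Hence, for [k] equal to 1
    or 2, [EC G = k] exactly when [m = k].  A connected graph with one edge is
    [K_2] and one with two edges is [P_3]; the complement of [C_4] consists of
    two disjoint edges, so no connected graph is isomorphic to it.

    The upper bound holds because the parts are nonempty and disjoint.  For the
    lower bound, let [F] be the set of edges that dominate on their own and [X]
    the set of the other edges.  The edges of [F] form [#|F|] singleton parts,
    and it remains to partition [X] into non-dominating sets, each forming a
    coalition with another one.

    - If [X] is empty, the singletons give [m] parts.
    - If neither [X] nor [F] is empty, [X] dominates, since each edge of [F] is
      adjacent to every other edge.  A dominating set that contains no
      dominating singleton always splits into at least two such parts
      ([exists_coalition_partition]): cut a minimal dominating subset in two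
      nonempty pieces, which are then coalition partners, and recurse on what
      is left as long as it dominates.  With the singletons this makes three.
    - If [F] is empty, there are at least two edges, so by connectedness each
      edge has a neighbour; then the complement of a minimal dominating set [M]
      dominates ([edge_dominating_compl], the edge version of a theorem of Ore).
      [M] and its complement each split in at least two parts, which makes
      four. *)

Set Implicit Arguments.
Unset Strict Implicit.
Unset Printing Implicit Defensive.

(** * Coalition partitions for an arbitrary family of dominating sets *)

Section CoalitionPartitions.

Variable T : finType.

Lemma partitionU (P Q : {set {set T}}) (X Y : {set T}) :
  partition P X -> partition Q Y -> [disjoint X & Y] ->
  partition (P :|: Q) (X :|: Y).
Proof.
move=> /and3P[/eqP cP tP nP] /and3P[/eqP cQ tQ nQ] dXY.
apply/and3P; split; last by rewrite inE negb_or nP.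
  by rewrite /cover bigcup_setU -/(cover P) -/(cover Q) cP cQ.
by apply: trivIsetU; rewrite // cP cQ.
Qed.

Lemma card_partitionU (P Q : {set {set T}}) (X Y : {set T}) :
  partition P X -> partition Q Y -> [disjoint X & Y] ->
  #|P :|: Q| = #|P| + #|Q|.
Proof.
move=> pP pQ dXY; apply/eqP; rewrite (leq_card_setU P Q).2.
apply/pred0P => A /=; apply/negP => /andP[AP AQ].
have /set0Pn[x xA] := partition_neq0 pP AP.
have := disjointFr dXY (subsetP (partitionS pP AP) _ xA).
by rewrite (subsetP (partitionS pQ AQ) _ xA).
Qed.

Lemma partition1 (A : {set T}) : A != set0 -> partition [set A] A.
Proof. by move=> A0; rewrite /partition cover1 trivIset1 eqxx inE eq_sym. Qed.

Lemma partition2 (A B : {set T}) :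
  A != set0 -> B != set0 -> [disjoint A & B] -> partition [set A; B] (A :|: B).
Proof. by move=> A0 B0; apply: partitionU; apply: partition1. Qed.

Lemma partition_singletons (A : {set T}) : partition [set [set x] | x in A] A.
Proof.
apply/and3P; split.
- by rewrite cover_imset; apply/eqP/setP => x;
    apply/bigcupP/idP => [[y yA /set1P->//]|xA]; exists x; rewrite ?set11.
- apply/trivIsetP => _ _ /imsetP[x _ ->] /imsetP[y _ ->] neq.
  by rewrite disjoints1 inE; apply: contraNneq neq => ->.
- by apply/imsetP => -[x _ /setP/(_ x)]; rewrite !inE eqxx.
Qed.

Variable dom : pred {set T}.

(** Unlike in an ec-partition of a graph, [X] need not be the whole ground set
    and [dom] is any family of sets; singleton dominating parts are excluded.
    The partner [B] is automatically distinct from [A], hence disjoint from it,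
    since [A :|: A] is not in [dom]. *)
Definition coalition_partition (P : {set {set T}}) (X : {set T}) : Prop :=
  partition P X /\
  {in P, forall A, ~~ dom A /\
                   exists2 B, B \in P & ~~ dom B && dom (A :|: B)}.

Lemma coalition_partitionU (P Q : {set {set T}}) (X Y : {set T}) :
  coalition_partition P X -> coalition_partition Q Y -> [disjoint X & Y] ->
  coalition_partition (P :|: Q) (X :|: Y).
Proof.
move=> [pP cP] [pQ cQ] dXY; split; first exact: partitionU.
move=> A /setUP[/cP|/cQ] [nA [B BP cAB]]; split=> //; exists B => //.
  by rewrite inE BP.
by rewrite inE BP orbT.
Qed.

Lemma coalition_partitionU1 (P : {set {set T}}) (X A B : {set T}) :
  coalition_partition P X -> A \in P -> B != set0 -> [disjoint B & X] ->
  ~~ dom B -> dom (B :|: A) ->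
  coalition_partition (B |: P) (B :|: X) /\ #|B |: P| = #|P|.+1.
Proof.
move=> [pP cP] AP B0 dBX nB domBA.
have [nA _] := cP A AP.
split; last by rewrite (card_partitionU (partition1 B0) pP dBX) cards1.
split; first exact: partitionU1.
move=> C /setU1P[-> | /cP[nC [D DP CD]]]; split=> //.
  by exists A; rewrite ?nA // inE AP orbT.
by exists D; rewrite // inE DP orbT.
Qed.

Lemma coalition_partition2 (A B : {set T}) :
  A != set0 -> B != set0 -> [disjoint A & B] ->
  ~~ dom A -> ~~ dom B -> dom (A :|: B) ->
  coalition_partition [set A; B] (A :|: B) /\ #|[set A; B]| = 2.
Proof.
move=> A0 B0 dAB nA nB AB; split; last first.
  rewrite (card_partitionU (partition1 A0) (partition1 B0) dAB).
  by rewrite !cards1.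
split; first exact: partition2.
move=> _ /set2P[] ->; split=> //; first by exists B; rewrite ?set22 ?nB.
by exists A; rewrite ?set21 // nA setUC.
Qed.

(** Both pieces are proper subsets of a minimal member of [dom]. *)
Lemma minset_split (M : {set T}) :
  minset dom M -> 1 < #|M| ->
  exists A B, [/\ A != set0, B != set0, [disjoint A & B], A :|: B = M &
                  ~~ dom A && ~~ dom B].
Proof.
move=> minM M1.
have /card_gt0P[x xM] : 0 < #|M| by apply: ltnW.
have ndom (A : {set T}) : A \subset M -> #|A| < #|M| -> ~~ dom A.
  by move=> sAM; apply: contraTN => /(minsetinf minM)/(_ sAM)->; rewrite ltnn.
have cM := cardsD1 x M; rewrite xM add1n in cM.
exists [set x], (M :\ x); split.
- by rewrite -card_gt0 cards1.
- by rewrite -card_gt0 -ltnS -cM.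
- by rewrite disjoints1 !inE eqxx.
- by rewrite setD1K.
- by rewrite !ndom ?sub1set ?cards1 ?subsetDl // cM.
Qed.

Lemma minset_coalition_partition (M : {set T}) :
  minset dom M -> 1 < #|M| ->
  exists2 P, coalition_partition P M & #|P| = 2.
Proof.
move=> minM M1.
have [A [B [A0 B0 dAB eM /andP[nA nB]]]] := minset_split minM M1.
have [] := coalition_partition2 A0 B0 dAB nA nB.
  by rewrite eM (minsetp minM).
by rewrite eM; exists [set A; B].
Qed.

(** Minimal dominating sets are removed from [X] and cut in two until the rest
    [R] no longer dominates; [R] then has to be placed next to the pieces [A]
    and [B] of the last minimal dominating set. *)
Lemma exists_coalition_partition (X : {set T}) :
  dom X -> (forall A : {set T}, A \subset X -> dom A -> 1 < #|A|) ->
  exists2 P, coalition_partition P X & 1 < #|P|.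
Proof.
have [n] := ubnP #|X|; elim: n X => // n IHn X /ltnSE leXn domX big.
have [M minM sMX] := minset_exists domX.
have M1 : 1 < #|M| by apply: big => //; apply: minsetp minM.
have eX : M :|: (X :\: M) = X by rewrite -{1}(setIidPr sMX) setID.
have dMR : [disjoint M & X :\: M].
  by rewrite disjoint_sym disjoints_subset subsetDr.
have [domR | ndomR] := boolP (dom (X :\: M)).
  have [||Q cQ Q1] := IHn (X :\: M) _ domR.
  - rewrite (leq_trans _ leXn) // -[in ltnRHS]eX cardsU.
    by rewrite (disjoint_setI0 dMR) cards0 subn0 -{1}[#|_|]add0n ltn_add2r ltnW.
  - by move=> A sAR; apply: big; apply: subset_trans sAR (subsetDl _ _).
  have [P cP P2] := minset_coalition_partition minM M1.
  exists (P :|: Q); first by rewrite -eX; apply: coalition_partitionU.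
  by rewrite (card_partitionU cP.1 cQ.1 dMR) P2.
have [A [B [A0 B0 dAB eM /andP[nA nB]]]] := minset_split minM M1.
move: dMR eX ndomR; set R := X :\: M => dMR eX ndomR.
have dRAB : [disjoint R & A :|: B] by rewrite eM disjoint_sym.
have eRAB : R :|: (A :|: B) = X by rewrite eM setUC.
(* If [R :|: A] dominates, [R] is a part of its own with partner [A];
   otherwise merging [R] into [A] keeps it non-dominating. *)
have [domRA | ndomRA] := boolP (dom (R :|: A)).
  have R0 : R != set0 by apply: contraNneq nA => R0; rewrite -(set0U A) -R0.
  have [|cAB AB2] := coalition_partition2 A0 B0 dAB nA nB.
    by rewrite eM (minsetp minM).
  have [cP cardP] := coalition_partitionU1 cAB (set21 A B) R0 dRAB ndomR domRA.
  by exists (R |: [set A; B]); rewrite -?eRAB // cardP AB2.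
have RA0 : R :|: A != set0 by rewrite setU_eq0 negb_and A0 orbT.
have dRA_B : [disjoint R :|: A & B].
  rewrite -setI_eq0 setIUl setU_eq0 !setI_eq0 dAB andbT disjoint_sym.
  by apply: disjointWl dMR; rewrite -eM subsetUr.
have [|cP P2] := coalition_partition2 RA0 B0 dRA_B ndomRA nB.
  by rewrite -setUA eRAB.
by exists [set R :|: A; B]; rewrite ?P2 // -eRAB setUA.
Qed.

End CoalitionPartitions.

(** * Edge domination *)

Section ConnectedGraph.

Variable G : sgraph.
Implicit Types (a b : {set G}) (D : {set {set G}}).

Lemma edgesP a :
  reflect (exists x y : G, adj x y /\ a = [set x; y]) (a \in edges G).
Proof.
rewrite inE; apply: (iffP existsP) => [[x /existsP[y /andP[xy /eqP->]]]|].
  by exists x, y.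
by case=> x [y [xy ->]]; exists x; apply/existsP; exists y; rewrite xy eqxx.
Qed.

Lemma edge_neq0 a : a \in edges G -> a != set0.
Proof.
by case/edgesP=> x [y [_ ->]]; apply/set0Pn; exists x; rewrite set21.
Qed.

Lemma edge_adjC a b : edge_adj a b = edge_adj b a.
Proof. by rewrite /edge_adj eq_sym setIC. Qed.

Lemma edge_dominatingP D :
  reflect (D \subset edges G /\
           forall a, a \in edges G -> a \notin D ->
                     exists2 d, d \in D & edge_adj a d)
          (edge_dominating D).
Proof.
apply: (iffP andP) => -[sD domD]; split=> //.
  move=> a aE aD; apply/exists_inP.
  by move/forall_inP: domD; apply; rewrite inE aD.
by apply/forall_inP => a /setDP[aE aD]; apply/exists_inP; apply: domD.
Qed.

Lemma edge_dominating_edges : edge_dominating (edges G).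
Proof. by apply/edge_dominatingP; split=> // a ->. Qed.

Lemma edge_dominating_neq0 D :
  0 < #|edges G| -> edge_dominating D -> D != set0.
Proof.
case/card_gt0P=> a aE /edge_dominatingP[_ domD]; apply/set0Pn.
have [aD|/(domD a aE)[d dD _]] := boolP (a \in D); first by exists a.
by exists d.
Qed.

(** If all the neighbours of some [a] in [D] were in [D], then [D :\ a] would
    still dominate: [a] through any neighbour, and the edges outside [D] because
    none of them relied on [a].  This contradicts minimality. *)
Lemma edge_dominating_compl D :
  (forall a, a \in edges G -> exists2 b, b \in edges G & edge_adj a b) ->
  minset (@edge_dominating G) D -> edge_dominating (edges G :\: D).
Proof.
move=> nbr minD; have /edge_dominatingP[sD domD] := minsetp minD.
apply/edge_dominatingP; split=> [|a aE]; first exact: subsetDl.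
rewrite inE aE andbT negbK => aD; apply/exists_inP.
apply: contraT; rewrite negb_exists_in => /forall_inP isoa.
have nbrD b : b \in edges G -> edge_adj a b -> b \in D.
  by move=> bE; apply: contraTT => bD; apply: isoa; rewrite inE bD.
suff /(minsetinf minD)/(_ (subsetDl _ _)) eD : edge_dominating (D :\ a).
  by move: aD; rewrite -eD !inE eqxx.
apply/edge_dominatingP; split=> [|b bE].
  exact: subset_trans (subsetDl _ _) sD.
rewrite 2!inE negb_and negbK => bDa.
have [eba | nba] := eqVneq b a.
  have [c cE ac] := nbr a aE; exists c; last by rewrite eba.
  by rewrite 2!inE nbrD // andbT eq_sym; case/andP: ac.
have bD : b \notin D by move: bDa; rewrite (negPf nba).
have [d dD bd] := domD b bE bD; exists d => //; rewrite 2!inE dD andbT.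
by apply: contraNneq bD => eda; apply: nbrD; rewrite // edge_adjC -eda.
Qed.

Lemma ec_partition_leq_EC (P : {set {set {set G}}}) :
  ec_partition P -> #|P| <= EC G.
Proof. by move=> ecP; apply: (bigmax_sup P). Qed.

Lemma EC_leq_card_edges : EC G <= #|edges G|.
Proof.
apply/bigmax_leqP => P /andP[pP _]; rewrite (card_partition pP) -sum1_card.
by apply: leq_sum => A AP; rewrite card_gt0 (partition_neq0 pP).
Qed.

(** These are the vertices of full degree in the line graph of [G]. *)
Definition full_edges : {set {set G}} :=
  [set a in edges G | edge_dominating [set a]].

Lemma EC_geq_full_edges (P : {set {set {set G}}}) :
  coalition_partition (@edge_dominating G) P (edges G :\: full_edges) ->
  #|full_edges| + #|P| <= EC G.
Proof.
move=> [pP cP].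
have sFE : full_edges \subset edges G.
  by apply/subsetP => a; rewrite inE => /andP[].
have pF := partition_singletons full_edges.
have dF : [disjoint full_edges & edges G :\: full_edges].
  by rewrite disjoint_sym disjoints_subset subsetDr.
have eF : full_edges :|: (edges G :\: full_edges) = edges G.
  by rewrite -[RHS](setID _ full_edges) (setIidPr sFE).
have pE := partitionU pF pP dF; rewrite eF in pE.
rewrite -(card_imset (mem full_edges) (@set1_inj _)).
rewrite -(card_partitionU pF pP dF).
apply: ec_partition_leq_EC; rewrite /ec_partition pE /=.
apply/forall_inP => A /setUP[/imsetP[a aF ->] | AP].
  by move: aF; rewrite inE cards1 eqxx => /andP[_ ->].
have [nA [B BP /andP[nB domAB]]] := cP A AP.
apply/orP; right; rewrite nA /=; apply/exists_inP.
have nBA : B != A by apply: contraNneq nA => eBA; rewrite -(setUid A) -{2}eBA.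
have sub C : C \in P -> C \subset edges G.
  by move=> CP; apply: subset_trans (partitionS pP CP) (subsetDl _ _).
exists B; first by rewrite in_setD1 in_setU nBA BP orbT.
rewrite /edge_coalition (sub A) ?(sub B) ?nA ?nB ?domAB ?andbT //.
by have /trivIsetP := partition_trivIset pP; apply; rewrite // eq_sym.
Qed.

(** * Isomorphisms with graphs on ordinals *)

Lemma edge_other_end a (y : G) :
  a \in edges G -> y \in a -> exists2 x, adj x y & a = [set x; y].
Proof.
case/edgesP=> u [v [uv ->]] /set2P[]->; last by exists u.
by exists v; rewrite 1?adj_sym // setUC.
Qed.

Lemma isomorphic_enum (x0 : G) n (e : rel 'I_n) (e_sym : symmetric e)
    (e_irr : irreflexive e) (s : seq G) :
  uniq s -> size s = n -> (forall x, x \in s) ->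
  (forall i j : 'I_n, adj (nth x0 s i) (nth x0 s j) = e i j) ->
  isomorphic G (SGraph e_sym e_irr).
Proof.
move=> Us sz_s mem_s adj_s.
have ltn_s x : index x s < n by rewrite -sz_s index_mem.
exists (fun x => Ordinal (ltn_s x)) => [|x y].
  exists (fun i : 'I_n => nth x0 s i) => [x | i] /=; first exact: nth_index.
  by apply: val_inj; rewrite /= index_uniq ?sz_s.
by rewrite /= -adj_s /= !nth_index.
Qed.

(** * Connected graphs *)

Hypothesis hG : connected G.

Lemma connected_closed_setT (S : {set G}) (x : G) :
  x \in S -> (forall u v, adj u v -> u \in S -> v \in S) -> S = [set: G].
Proof.
move=> xS clS; apply/setP => y; rewrite inE.
have cl : closed (@adj G) S.
  by apply: intro_closed clS; apply/sym_connect_sym/adj_sym.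
by rewrite -(closed_connect cl (hG.2 x y)).
Qed.

(** The end points of an edge without neighbours form a connected component,
    which leaves no vertex for a second edge. *)
Lemma edge_neighbor a :
  1 < #|edges G| -> a \in edges G ->
  exists2 b, b \in edges G & edge_adj a b.
Proof.
move=> E1 aE; apply/exists_inP; apply: contraT; rewrite negb_exists_in.
move=> /forall_inP isoa.
have [b bE nab] : exists2 b, b \in edges G & a != b.
  have /card_gt0P[b] : 0 < #|edges G :\ a|.
    by move: E1; rewrite (cardsD1 a) aE.
  by rewrite !inE eq_sym => /andP[nab bE]; exists b; rewrite ?inE.
have /set0Pn[x xa] := edge_neq0 aE.
have aT : a = [set: G].
  apply: (connected_closed_setT xa) => u v uv ua.
  have uvE : [set u; v] \in edges G by apply/edgesP; exists u, v.
  have := isoa _ uvE; rewrite /edge_adj negb_and !negbK => /orP[/eqP->|].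
    by rewrite set22.
  by move=> /eqP/setP/(_ u); rewrite !inE eqxx ua.
have := isoa b bE; rewrite /edge_adj nab aT setTI negbK.
by rewrite (negPf (edge_neq0 bE)).
Qed.

Lemma vertex_on_edge (z : G) :
  0 < #|edges G| -> exists2 a, a \in edges G & z \in a.
Proof.
case/card_gt0P=> a aE; have /set0Pn[x xa] := edge_neq0 aE.
suff coverT : cover (edges G) = [set: G].
  by apply/bigcupP; rewrite -/(cover _) coverT.
apply: (@connected_closed_setT _ x); first by apply/bigcupP; exists a.
move=> u v uv _; apply/bigcupP; exists [set u; v]; last exact: set22.
by apply/edgesP; exists u, v.
Qed.

Lemma EC_geq_min_card_edges : minn #|edges G| 3 <= EC G.
Proof.
have [-> | E_gt0] := posnP #|edges G|; first by rewrite min0n.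
have [X0 | X0] := eqVneq (edges G :\: full_edges) set0.
  have: coalition_partition (@edge_dominating G) set0 (edges G :\: full_edges).
    by split; rewrite ?X0 ?partition_set0 // => A; rewrite inE.
  move/EC_geq_full_edges; rewrite cards0 addn0; apply: leq_trans.
  by rewrite geq_min subset_leq_card // -setD_eq0 X0.
have E1 : 1 < #|edges G|.
  rewrite ltn_neqAle E_gt0 andbT.
  apply: contraNneq X0 => /esym/eqP/cards1P[a eE].
  (* A unique edge dominates, so it would be full. *)
  rewrite setD_eq0 {1}eE sub1set inE {1}eE set11 /= -[X in edge_dominating X]eE.
  exact: edge_dominating_edges.
have nbr a : a \in edges G -> exists2 b, b \in edges G & edge_adj a b.
  exact: edge_neighbor.
have big (A : {set {set G}}) :
  A \subset edges G :\: full_edges -> edge_dominating A -> 1 < #|A|.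
  move=> sA domA; have A0 := edge_dominating_neq0 E_gt0 domA.
  rewrite ltn_neqAle card_gt0 A0 andbT eq_sym.
  apply/negP => /cards1P[a eA]; move: sA domA; rewrite eA sub1set => /setDP[aE].
  by rewrite inE aE /= => /negPf->.
have [F0 | [a aF]] := set_0Vmem full_edges.
  have EF : edges G :\: full_edges = edges G by rewrite F0 setD0.
  rewrite EF in big.
  have [M minM sM] := minset_exists edge_dominating_edges.
  have M1 : 1 < #|M| by apply: big => //; apply: minsetp minM.
  have [P cP P2] := minset_coalition_partition minM M1.
  have [|Q cQ Q1] :=
    exists_coalition_partition (edge_dominating_compl nbr minM).
    move=> A sA; apply: big; apply: subset_trans sA (subsetDl _ _).
  have dM : [disjoint M & edges G :\: M].
    by rewrite disjoint_sym disjoints_subset subsetDr.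
  have := coalition_partitionU cP cQ dM.
  rewrite -{1}(setIidPr sM) setID -EF => /EC_geq_full_edges.
  rewrite F0 cards0 (card_partitionU cP.1 cQ.1 dM) P2 add0n.
  by apply: leq_trans; rewrite geq_min add2n !ltnS (ltnW Q1) orbT.
have domX : edge_dominating (edges G :\: full_edges).
  apply/edge_dominatingP; split=> [|b bE bX]; first exact: subsetDl.
  have /set0Pn[c cX] := X0; exists c => //.
  have: b \in full_edges by move: bX; rewrite inE bE andbT negbK.
  rewrite inE => /andP[_ /edge_dominatingP[_ /(_ c)]].
  have [cE cF] := setDP cX.
  have ncb : c \notin [set b] by rewrite inE; apply: contraNneq bX => <-.
  by case=> // d /set1P->; rewrite edge_adjC.
have [P cP P1] := exists_coalition_partition domX big.
apply: leq_trans (EC_geq_full_edges cP).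
apply: leq_trans (geq_minr _ _) _; apply: (@leq_add 1 2) => //.
by apply/card_gt0P; exists a.
Qed.

Lemma isomorphic_K2 : #|edges G| = 1 -> isomorphic G (complete_graph 2).
Proof.
move=> E1; have [a eE] := cards1P (introT eqP E1).
have /edgesP[x [y [xy ea]]] : a \in edges G by rewrite eE set11.
have nxy : x != y by apply: contraTneq xy => ->; rewrite adj_irrefl.
apply: (@isomorphic_enum x _ _ _ _ [:: x; y]) => //= [|w|].
- by rewrite inE nxy.
- have [|b] := vertex_on_edge w; first by rewrite E1.
  by rewrite eE => /set1P->; rewrite ea !inE.
by do 2![case=> [[|[|//]] ?]] => //=; rewrite ?adj_irrefl // adj_sym.
Qed.

(** Connectedness makes the two edges share a vertex, which is the middle of the
    path, and leaves no vertex outside them. *)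
Lemma isomorphic_P3 : #|edges G| = 2 -> isomorphic G (path_graph 3).
Proof.
move=> E2; have [a [b [nab eE]]] := cards2P _ (introT eqP E2).
have aE : a \in edges G by rewrite eE set21.
have bE : b \in edges G by rewrite eE set22.
have /set0Pn[y /setIP[ya yb]] : a :&: b != set0.
  have [|c] := edge_neighbor _ aE; first by rewrite E2.
  by rewrite eE => /set2P[]->; rewrite /edge_adj ?eqxx // => /andP[].
have [x xy ea] := edge_other_end aE ya.
have [z zy eb] := edge_other_end bE yb.
have nxy : x != y by apply: contraTneq xy => ->; rewrite adj_irrefl.
have nzy : z != y by apply: contraTneq zy => ->; rewrite adj_irrefl.
have nxz : x != z by apply: contraNneq nab => exz; rewrite ea eb exz.
have xz : adj x z = false.
  apply: contraTF isT => xz.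
  have : [set x; z] \in edges G by apply/edgesP; exists x, z.
  rewrite eE => /set2P[] exz; [move: ya | move: yb]; rewrite -exz !inE;
  by rewrite ![y == _]eq_sym (negPf nxy) (negPf nzy).
apply: (@isomorphic_enum x _ _ _ _ [:: x; y; z]) => //= [|w|].
- by rewrite !inE negb_or nxy nxz eq_sym nzy.
- have [|c] := vertex_on_edge w; first by rewrite E2.
  by rewrite eE => /set2P[]->; rewrite ?ea ?eb !inE => /orP[]->; rewrite ?orbT.
have [zx yx yz] : [/\ adj z x = false, adj y x & adj y z].
  by rewrite adj_sym xz ![adj y _]adj_sym.
by do 2![case=> [[|[|[|//]]] ?]] => //=; rewrite ?adj_irrefl.
Qed.

(** In the complement of [C_4] each vertex is adjacent only to the opposite one
    of the cycle, so edges preserve the parity of the index. *)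
Lemma not_isomorphic_2K2 : ~ isomorphic G (compl_graph (cycle_graph 4)).
Proof.
case=> f [g fK gK] mono_f.
pose i0 : 'I_4 := @Ordinal 4 0 isT; pose i1 : 'I_4 := @Ordinal 4 1 isT.
have par (i j : 'I_4) : compl_rel (G := cycle_graph 4) i j -> odd i = odd j.
  by case: i j => [[|[|[|[|//]]]] ?] [[|[|[|[|//]]]] ?].
have /setP/(_ (g i1)) : [set u | ~~ odd (f u : 'I_4)] = [set: G].
  apply: (@connected_closed_setT _ (g i0)) => [|u v]; first by rewrite inE gK.
  by rewrite -mono_f !inE => /par->.
by rewrite !inE gK.
Qed.

End ConnectedGraph.

(** * Counting the edges of the small graphs *)

Lemma card_edges_isomorphic (G H : sgraph) :
  isomorphic G H -> #|edges G| = #|edges H|.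
Proof.
case=> f [g fK gK] mono_f.
suff <- : [set f @: (a : {set G}) | a in edges G] = edges H.
  by rewrite card_imset //; apply/imset_inj/can_inj/fK.
apply/setP => b.
apply/imsetP/edgesP => [[a /edgesP[x [y [xy ->]]] ->] | [x [y [xy ->]]]].
  by exists (f x), (f y); rewrite mono_f imsetU1 imset_set1.
exists [set g x; g y]; last by rewrite imsetU1 imset_set1 !gK.
by apply/edgesP; exists (g x), (g y); rewrite -mono_f !gK.
Qed.

Lemma card_edges_K2 : #|edges (complete_graph 2)| = 1.
Proof.
suff -> : edges (complete_graph 2) = [set [set: complete_graph 2]].
  exact: cards1.
apply/setP => a; apply/edgesP/set1P => [[x [y [xy ->]]] | ->].
  by apply/eqP; rewrite eqEcard subsetT cards2 (xy : x != y) cardsT card_ord.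
exists ord0, ord_max; split=> //; apply/setP.
by case=> [[|[|//]] ?]; rewrite !inE.
Qed.

Lemma card_edges_path n : #|edges (path_graph n.+1)| = n.
Proof.
pose e (i : 'I_n) : {set path_graph n.+1} :=
  [set widen_ord (leqnSn n) i; lift ord0 i].
have e_inj : injective e.
  move=> i j eij; apply/val_inj/eqP => /=.
  have: widen_ord (leqnSn n) i \in e j by rewrite -eij set21.
  have: widen_ord (leqnSn n) j \in e i by rewrite eij set21.
  rewrite !inE -!val_eqE /= /bump /= !add1n => /orP[/eqP->// | /eqP->].
  by rewrite !ltn_eqF // ltnW.
suff -> : edges (path_graph n.+1) = [set e i | i : 'I_n].
  by rewrite card_imset // card_ord.
apply/setP => a.
apply/edgesP/imsetP => [[x [y [xy ->]]] | [i _ ->]].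
  wlog {xy} xy : x y / x.+1 = y :> nat => [hw|].
    by case/orP: xy => /eqP /hw // [i _ e_i]; exists i; rewrite // setUC.
  have xn : x < n by rewrite -ltnS xy.
  exists (Ordinal xn) => //; congr [set _; _]; exact: val_inj.
exists (widen_ord (leqnSn n) i), (lift ord0 i); split=> //.
by rewrite /= /path_rel /= /bump add1n eqxx.
Qed.

(** * Graphs with a small edge coalition number *)

Theorem theorem5p4 (G : sgraph) (hG : connected G) :
  (EC G = 1 <-> isomorphic G (complete_graph 2)) /\
  (EC G = 2 <-> isomorphic G (path_graph 3) \/
                isomorphic G (compl_graph (cycle_graph 4))).
Proof.
have leEC := EC_leq_card_edges G; have geEC := EC_geq_min_card_edges hG.
have EC_small k : k < 3 -> EC G = k <-> #|edges G| = k.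
  move=> k3; split=> [eEC | eE].
    rewrite eEC in leEC geEC; apply/eqP; rewrite eqn_leq leEC andbT.
    by move: geEC; rewrite geq_min [3 <= k]leqNgt k3 orbF.
  rewrite eE in leEC geEC; apply/eqP; rewrite eqn_leq leEC.
  by rewrite (minn_idPl (ltnW k3)) in geEC.
split.
  apply: (iff_trans (EC_small 1 isT)); split; first exact: isomorphic_K2.
  by move/card_edges_isomorphic->; apply: card_edges_K2.
apply: (iff_trans (EC_small 2 isT)); split.
  by left; apply: isomorphic_P3.
by case=> [/card_edges_isomorphic-> | /(not_isomorphic_2K2 hG)//];
   apply: card_edges_path.
Qed.
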